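(* Let $A\in\mathscr{B}(\mathscr{H})$ and let $0\le t\le 1$. Then \[ \omega(A)^2\le \frac12\left\||A|^2+|A^*|^2-\frac{t(1-t)}{R}\bigl(|A|-|A^*|\bigr)^2\right\|, \] where $R=\max\{t,1-t\}$.
   Context: $\mathscr{B}(\mathscr{H})$ is the $C^*$-algebra of all bounded linear operators on a complex Hilbert space $\mathscr{H}$ with inner product $\langle\cdot,\cdot\rangle$. For $T\in\mathscr{B}(\mathscr{H})$: $\omega(T)=\sup_{\|x\|=1}|\langle Tx,x\rangle|$ is the numerical radius and $\omega(T)^2$ means $(\omega(T))^2$; $\|T\|=\sup_{\|x\|=1}\|Tx\|$ is the operator norm; $T^*$ is the adjoint; $|T|=(T^*T)^{1/2}$. *)

(* Defs.v *)
From HB Require Import structures.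
From mathcomp Require Import all_boot all_order all_algebra.
From mathcomp Require Import all_classical all_reals all_analysis.
From mathcomp Require Import sesquilinear complex.

Set Implicit Arguments.
Unset Strict Implicit.
Unset Printing Implicit Defensive.

Import Order.TTheory GRing.Theory Num.Theory.
Import numFieldNormedType.Exports.

Local Open Scope classical_set_scope.
Local Open Scope ring_scope.
Local Open Scope complex_scope.

(* The inner product is linear in its first argument and conjugate-linear in
   the second. *)
HB.mixin Record CompleteNormedModule_isHilbert (R : realType) H
    of CompleteNormedModule R[i] H := {
  inner : {dot H for (@Num.conj R[i])} ;
  inner_normE : forall x : H, inner x x = `|x| ^+ 2
}.

#[short(type="hilbertType")]
HB.structure Definition Hilbert (R : realType) :=
  {H of CompleteNormedModule_isHilbert R H & CompleteNormedModule R[i] H}.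

Local Notation "''[' x , y ]" := (inner x y) : ring_scope.

Section operators.
Context {R : realType} {H : hilbertType R}.
Implicit Types T : H -> H.

Definition bounded_operator T :=
  linear T /\ exists M : R, forall x, `|T x| <= M%:C * `|x|.

(* Norms and moduli take their values in R[i]; they are real, and Re recovers
   the element of R.  Over a trivial H the supremum is sup set0 = 0. *)
Definition opnorm T : R :=
  sup [set complex.Re `|T x| | x in [set x : H | `|x| = 1]].

Definition numerical_radius T : R :=
  sup [set complex.Re `|'[T x, x]| | x in [set x : H | `|x| = 1]].

(* get picks an element of the set; for a bounded operator T the adjoint exists
   and is unique, by the Riesz representation theorem. *)
Definition adjoint T : H -> H :=
  get [set S : H -> H | bounded_operator S /\
                        forall x y, '[T x, y] = '[x, S y]].

(* The order on R[i] makes 0 <= z mean that z is real and nonnegative. *)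
Definition positive_operator T :=
  bounded_operator T /\ forall x, 0 <= '[T x, x].

Definition op_sqr T : H -> H := T \o T.

(* The positive square root, which exists and is unique for T positive. *)
Definition op_sqrt T : H -> H :=
  get [set S : H -> H | positive_operator S /\ op_sqr S = T].

Definition op_abs T : H -> H := op_sqrt (adjoint T \o T).

End operators.

(* Main.v *)
Require Import Defs.
From HB Require Import structures.
From mathcomp Require Import all_boot all_order all_algebra.
From mathcomp Require Import all_classical all_reals all_analysis.
From mathcomp Require Import sesquilinear complex.
From mathcomp Require Import ring lra.

Import Order.TTheory GRing.Theory Num.Theory.
Import numFieldNormedType.Exports.

Local Open Scope classical_set_scope.
Local Open Scope ring_scope.
Local Open Scope complex_scope.

(** Write P = |A| and Q = |A^*|, and let c = t (1 - t) / max (t, 1 - t), which is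
    the smaller of t and 1 - t, so that c <= 1/2.  As (P - Q)^2 is positive,
    replacing c by 1/2 only decreases the operator on the right, and the
    parallelogram law then gives
      P^2 + Q^2 - c (P - Q)^2 >= (P + Q)^2 / 2
    ([half_sum_sqr_le]).  Hence it is enough that, for every unit vector x,
      |<A x, x>| <= <(P + Q) x, x> / 2 <= ||(P + Q) x|| / 2
    ([numerical_value_le]), which is an additive form of the mixed Schwarz
    inequality, 2 Re <A x, y> <= <P x, x> + <Q y, y> ([mixed_schwarz]), with y
    a unimodular multiple of x chosen to make <A x, y> nonnegative.

    The mixed Schwarz inequality rests on the intertwining relation
    P A^* = A^* Q ([op_abs_adjoint]).  For y = Q z that relation turns the
    inequality into <P v, v> >= 0 at v = x - A^* z, and every y is a vector of
    the range of Q up to an error on which Q, and therefore A^*, is small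
    ([range_plus_small_image]).  As for the relation itself,
    Z = P A^* - A^* Q satisfies P Z = - Z Q, because P^2 = A^* A and
    Q^2 = A A^*, so that (1 + P/M)^n Z = Z (1 - Q/M)^n for all n.  The right
    side stays bounded while the left side grows unless P Z = 0
    ([anticommuting_intertwiner]), and P Z = 0 forces A Z = 0 and then Z = 0.

    Adjoints come from the Riesz representation theorem, proved by minimising
    ||x||^2 - 2 phi(x) ([riesz_representation]).  The positive square root of
    1 - B, for B a symmetric contraction, is 1 - Y with Y the limit of
    Y_(n+1) = (B + Y_n^2) / 2; the increments of Y_n are dominated by those of
    the same recursion on real numbers started at 0 with B replaced by 1
    ([sqrt_iterB]).

    Only the real part of the inner product is manipulated; the complex
    structure matters for the symmetry of positive operators, for the
    linearity of adjoints and for the choice of the phase. *)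

(** * The underlying real Hilbert space *)

Section RealStructure.
Context {R : realType} {H : hilbertType R}.
Implicit Types (x y z : H) (r : R).

Definition rip x y : R := complex.Re (inner x y).
Definition rnorm x : R := complex.Re `|x|.

Lemma normE_rnorm x : `|x| = (rnorm x)%:C.
Proof. by rewrite /rnorm RRe_real ?normr_real. Qed.

Lemma rnorm_ge0 x : 0 <= rnorm x.
Proof. by rewrite -lecR -normE_rnorm; exact: normr_ge0. Qed.

Lemma inner_conj x y : inner x y = Num.conj (inner y x).
Proof. by rewrite hermC expr0 mul1r. Qed.

Lemma ripC x y : rip x y = rip y x.
Proof. by rewrite /rip inner_conj; case: (inner y x). Qed.

Lemma ripDl x y z : rip (x + y) z = rip x z + rip y z.
Proof. by rewrite /rip linearDl raddfD. Qed.

Lemma ripDr x y z : rip z (x + y) = rip z x + rip z y.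
Proof. by rewrite ripC ripDl !(ripC z). Qed.

Lemma ripNl x z : rip (- x) z = - rip x z.
Proof. by rewrite /rip linearNl raddfN. Qed.

Lemma ripNr x z : rip z (- x) = - rip z x.
Proof. by rewrite ripC ripNl ripC. Qed.

Lemma ripZl r x z : rip (r%:C *: x) z = r * rip x z.
Proof.
rewrite /rip linearZl_LR /=; case: (inner x z) => a b /=.
by rewrite mul0r subr0.
Qed.

Lemma ripZr r x z : rip z (r%:C *: x) = r * rip z x.
Proof. by rewrite ripC ripZl ripC. Qed.

Definition ripE := (ripDl, ripDr, ripNl, ripNr, ripZl, ripZr).

Lemma rip_self x : rip x x = rnorm x ^+ 2.
Proof.
rewrite /rip inner_normE normE_rnorm expr2 /=.
by rewrite mul0r subr0 expr2.
Qed.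

Lemma rnorm_eq0 x : rnorm x = 0 -> x = 0.
Proof. by move=> h; apply/eqP; rewrite -normr_eq0 normE_rnorm h. Qed.

Lemma ler_rnormD x y : rnorm (x + y) <= rnorm x + rnorm y.
Proof.
rewrite -lecR rmorphD /= -!normE_rnorm; exact: ler_normD.
Qed.

Lemma rnormN x : rnorm (- x) = rnorm x.
Proof. by rewrite /rnorm normrN. Qed.

Lemma rnormZ (c : R[i]) x : rnorm (c *: x) = complex.Re `|c| * rnorm x.
Proof.
apply: complexI; rewrite -normE_rnorm normrZ normE_rnorm rmorphM /=.
by rewrite RRe_real.
Qed.

Lemma rnormZr r x : rnorm (r%:C *: x) = `|r| * rnorm x.
Proof.
rewrite rnormZ; congr (_ * _).
by rewrite normc_def /= expr0n addr0 sqrtr_sqr.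
Qed.

(** Cauchy-Schwarz: for nonzero x and y, expand the square of the norm of
    |y| x - |x| y and divide by 2 |x| |y|. *)
Lemma rip_le x y : rip x y <= rnorm x * rnorm y.
Proof.
have := rnorm_ge0 x; rewrite le_eqVlt => /predU1P[h|x0].
  by rewrite {1}(rnorm_eq0 _ (esym h)) /rip linear0l -h mul0r.
have := rnorm_ge0 y; rewrite le_eqVlt => /predU1P[h|y0].
  by rewrite {1}(rnorm_eq0 _ (esym h)) /rip linear0r -h mulr0.
have := sqr_ge0 (rnorm ((rnorm y)%:C *: x - (rnorm x)%:C *: y)).
rewrite -rip_self !ripE !rip_self (ripC y x) => h.
have : 0 <= 2 * (rnorm x * rnorm y) * (rnorm x * rnorm y - rip x y) by lra.
by rewrite pmulr_rge0 ?subr_ge0 // !mulr_gt0.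
Qed.

Lemma normr_rip_le x y : `|rip x y| <= rnorm x * rnorm y.
Proof. by rewrite ler_norml lerNl -ripNl -{1}(rnormN x) !rip_le. Qed.

Lemma rip_ext x y : (forall z, rip x z = rip y z) -> x = y.
Proof.
move=> h; apply/eqP; rewrite -subr_eq0; apply/eqP/rnorm_eq0/eqP.
by rewrite -sqrf_eq0 -rip_self ripDl ripNl h subrr.
Qed.

(** Completeness in the form used below: a vanishing bound on the tails of
    a sequence passes to the distance to the limit.  Keeping the explicit
    bound lets later limit arguments be stated as real inequalities. *)
Lemma hilbert_complete (u : nat -> H) (e : nat -> R) :
  (forall n m, (n <= m)%N -> rnorm (u m - u n) <= e n) ->
  e @ \oo --> 0 -> exists l, forall n, rnorm (l - u n) <= e n.
Proof.
move=> ue e0.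
have : cvg (u @ \oo).
  apply/cauchy_cvgP/cauchy_exP => -[r b]; rewrite ltcE /= => /andP[/eqP -> r0].
  move/cvgrPdist_lt : e0 => /(_ r r0) [N _ HN].
  exists (u N); exists N => // m /= Nm.
  rewrite -ball_normE /= normE_rnorm ltcR -rnormN opprB.
  apply: le_lt_trans (ue _ _ Nm) _.
  by have := HN N (leqnn N); rewrite /= sub0r normrN; apply: le_lt_trans (ler_norm _).
move=> /cvgrPdist_lt cu; exists (lim (u @ \oo)) => n.
apply/ler_addgt0Pr => d d0.
have [|N _ HN] := cu d%:C; first by rewrite ltcR.
have := HN (maxn N n) (leq_maxl _ _); rewrite /= normE_rnorm ltcR => h.
rewrite -(subrKA (u (maxn N n))) (le_trans (ler_rnormD _ _)) //.
rewrite addrC.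
by rewrite lerD ?(ltW h) // ue // leq_maxr.
Qed.

(** An error that is arbitrarily small along a vanishing sequence is no
    error. *)
Lemma le0_of_cvg0 (c K : R) (e : nat -> R) :
  (forall n, c <= K * e n) -> e @ \oo --> 0 -> c <= 0.
Proof.
move=> h e0.
have: (fun n => K * e n) @ \oo --> K * 0 by apply: cvgM => //; exact: cvg_cst.
rewrite mulr0 => cv; rewrite -(cvg_lim _ cv) //.
apply: limr_ge; first by apply/cvg_ex; exists 0.
exact: nearW.
Qed.

Lemma bounded_rnormP (T : H -> H) : bounded_operator T <->
  linear T /\ exists2 M : R, 0 < M & forall x, rnorm (T x) <= M * rnorm x.
Proof.
split=> -[lT [M]]; last first.
  move=> M0 h; split => //; exists M => x.
  by rewrite !normE_rnorm -rmorphM lecR.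
move=> h; split => //; exists (`|M| + 1); first by rewrite ltr_wpDl.
move=> x; have := h x; rewrite !normE_rnorm -rmorphM lecR => /le_trans; apply.
by rewrite ler_wpM2r ?rnorm_ge0 // ler_wpDr // ler_norm.
Qed.

End RealStructure.

(** * Riesz representation, adjoints and positive operators *)

Section Riesz.
Context {R : realType} {H : hilbertType R}.
Implicit Types (x y z : H) (r : R).

(** Minimise J x = |x|^2 - 2 phi x, which is bounded below because phi is
    bounded.  The parallelogram law makes a minimising sequence Cauchy, and
    minimality along that sequence makes 2 s (<l, v> - phi v) + s^2 |v|^2
    nonnegative for every s, where l is the limit; so <l, v> = phi v. *)
Lemma riesz_representation (phi : H -> R) (M : R) : 0 <= M ->
  (forall x y, phi (x + y) = phi x + phi y) ->
  (forall r x, phi (r%:C *: x) = r * phi x) ->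
  (forall x, phi x <= M * rnorm x) ->
  exists l, forall v, rip l v = phi v.
Proof.
move=> M0 phiD phiZ phiM.
pose J x := rnorm x ^+ 2 - 2 * phi x.
have Jlb x : - M ^+ 2 <= J x.
  have := phiM x; have := sqr_ge0 (rnorm x - M); rewrite /J; lra.
have infJ : has_inf (range J).
  by split; [exists (J 0), 0 | exists (- M ^+ 2) => _ [x _ <-]].
pose m := inf (range J).
have mJ x : m <= J x by apply: ge_inf; [exact: infJ.2 | exists x].
pose d n : R := n.+1%:R^-1.
have d_gt0 n : 0 < d n by rewrite invr_gt0.
have /choice[u uJ] : forall n, exists x, J x <= m + d n ^+ 2.
  move=> n; have [_ [x _ <-] xm] := inf_adherent (exprn_gt0 2 (d_gt0 n)) infJ.
  by exists x; exact: ltW.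
have d_ge0 n : 0 <= d n by exact: ltW.
have d_le n k : (n <= k)%N -> d k <= d n.
  by move=> nk; rewrite lef_pV2 ?posrE // ler_nat.
have d_cvg : d @ \oo --> 0 by exact: cvg_harmonic.
have JD x v s : J (x + s%:C *: v) =
    J x + 2 * s * (rip x v - phi v) + s ^+ 2 * rnorm v ^+ 2.
  rewrite /J -!rip_self !ripE phiD phiZ (ripC v x); ring.
have [n k nk||l lu] := @hilbert_complete R H u (fun n => 2 * d n).
(* J at the midpoint is at least the infimum, and
   |u k - u n|^2 = 2 J (u n) + 2 J (u k) - 4 J (midpoint) *)
- have := mJ (u n + (2^-1)%:C *: (u k - u n)).
  rewrite JD => mid.
  have : J (u k) = J (u n + 1%:C *: (u k - u n)).
    by rewrite scale1r addrC subrK.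
  rewrite JD => end_.
  have dk : d k ^+ 2 <= d n ^+ 2.
    by rewrite ler_sqr ?nnegrE // d_le.
  have := uJ n; have := uJ k => hk hn.
  rewrite -ler_sqr ?nnegrE ?rnorm_ge0 ?mulr_ge0 //.
  rewrite exprMn.
  lra.
- rewrite -[X in _ --> X](mulr0 2); apply: cvgM => //; exact: cvg_cst.
exists l => v.
have var s : 0 <= 2 * s * (rip l v - phi v) + s ^+ 2 * rnorm v ^+ 2.
  rewrite -oppr_le0; apply: (@le0_of_cvg0 _ _ (1 + 4 * `|s| * rnorm v) d) => // n.
  have := mJ (u n + s%:C *: v); rewrite JD => h1.
  have h2 := uJ n.
  have h3 : d n ^+ 2 <= d n.
    by rewrite expr2 ger_pMl // invf_le1 // ler1n.
  have h4 : s * (rip (u n) v - rip l v) <= `|s| * (2 * d n * rnorm v).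
    have -> : s * (rip (u n) v - rip l v) = rip (l - u n) ((- s)%:C *: v).
      by rewrite !ripE; ring.
    apply: (le_trans (rip_le _ _)); rewrite rnormZr normrN mulrCA.
    by rewrite ler_wpM2l // ler_wpM2r ?rnorm_ge0.
  lra.
pose g := rip l v - phi v; pose N := rnorm v ^+ 2.
have N1 : 0 < N + 1 by rewrite ltr_wpDl // sqr_ge0.
(* this step size avoids the division by N = |v|^2, which may vanish, and still
   makes the quadratic in s negative when g is nonzero *)
have := var (- g / (N + 1)); rewrite -/g -/N => h.
apply/eqP; rewrite -subr_eq0 -/g -sqrf_eq0 eq_le sqr_ge0 andbT.
have e : 2 * (- g / (N + 1)) * g + (- g / (N + 1)) ^+ 2 * N =
    - (g ^+ 2 * ((N + 2) / (N + 1) ^+ 2)).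
  by field; rewrite gt_eqF.
move: h; rewrite e oppr_ge0 pmulr_lle0 // divr_gt0 ?exprn_gt0 //.
by rewrite ltr_wpDl // sqr_ge0.
Qed.

Lemma rip_ii x y : rip ('i *: x) ('i *: y) = rip x y.
Proof.
rewrite /rip linearZl_LR linearZr_LR /=; case: (inner x y) => a b /=; ring.
Qed.

Lemma scale_ii x : 'i *: ('i *: x) = - x.
Proof. by rewrite scalerA -expr2 sqr_i scaleN1r. Qed.

Lemma rip_iC x y : rip ('i *: x) y = - rip x ('i *: y).
Proof. by rewrite -rip_ii scale_ii ripNl. Qed.

(** The imaginary part of the inner product is recovered from its real part,
    so an identity that holds for real parts and complex-linear operators
    holds for the full inner product. *)
Lemma innerE x y : inner x y = rip x y +i* (- rip ('i *: x) y).
Proof.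
by rewrite /rip linearZl_LR /=; case: (inner x y) => a b /=; congr (_ +i* _); ring.
Qed.

Section Linear.
Variables (T : H -> H) (lT : linear T).

Lemma linop0 : T 0 = 0.
Proof. by have := lT (-1) 0 0; rewrite scaler0 addr0 scaleN1r addNr. Qed.

Lemma linopD x y : T (x + y) = T x + T y.
Proof. by have := lT 1 x y; rewrite !scale1r. Qed.

Lemma linopZ a x : T (a *: x) = a *: T x.
Proof. by have := lT a x 0; rewrite linop0 !addr0. Qed.

Lemma linopN x : T (- x) = - T x.
Proof. by rewrite -scaleN1r linopZ scaleN1r. Qed.

Definition linopE := (linopD, linopN, linopZ).

End Linear.

(** For a complex-linear T this determines the same S as the complex
    relation, see [innerE]. *)
Definition is_adjoint (T S : H -> H) := forall x y, rip (T x) y = rip x (S y).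

Lemma adjointP (T : H -> H) : bounded_operator T ->
  bounded_operator (adjoint T) /\ is_adjoint T (adjoint T).
Proof.
move=> bT; have /bounded_rnormP[lT [M M0 TM]] := bT.
have [S TS] : exists S, is_adjoint T S.
  suff /choice[S TS] : forall y, exists z, forall x, rip z x = rip (T x) y.
    by exists S => x y; rewrite -TS ripC.
  move=> y; apply: (@riesz_representation _ (M * rnorm y)) => //.
  - by rewrite mulr_ge0 ?rnorm_ge0 // ltW.
  - by move=> a b; rewrite linopD // ripDl.
  - by move=> r a; rewrite linopZ // ripZl.
  - move=> x; apply: (le_trans (rip_le _ _)).
    by rewrite -mulrA (mulrC (rnorm y)) mulrA ler_wpM2r // rnorm_ge0.
have iTS x y : inner (T x) y = inner x (S y).
  by rewrite !innerE -linopZ // !TS.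
have lS : linear S.
  move=> a y z; apply: rip_ext => x; rewrite !(ripC _ x) /rip -iTS.
  by rewrite !linearDr /= !linearZr_LR /= !iTS.
have bS : bounded_operator S.
  apply/bounded_rnormP; split => //; exists M => // y.
  have := rnorm_ge0 (S y); rewrite le_eqVlt => /predU1P[<-|S0].
    by rewrite mulr_ge0 ?rnorm_ge0 // ltW.
  rewrite -(ler_pM2l S0) -expr2 -rip_self -TS.
  apply: (le_trans (rip_le _ _)).
  by rewrite mulrA (mulrC (rnorm (S y))) ler_wpM2r // rnorm_ge0.
have [bA iA] := getPex (ex_intro (fun S => bounded_operator S /\
  forall x y, inner (T x) y = inner x (S y)) S (conj bS iTS)).
by split => // x y; rewrite /rip iA.
Qed.

Lemma adjointK (T : H -> H) : bounded_operator T -> adjoint (adjoint T) = T.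
Proof.
move=> /adjointP[/adjointP[_ aaT] aT]; apply/funext => x; apply: rip_ext => y.
by rewrite ripC -aaT ripC -aT.
Qed.

Definition symmetric_operator (T : H -> H) := is_adjoint T T.

Definition nonneg_form (T : H -> H) := forall x, 0 <= rip (T x) x.

(** Positivity over the complex numbers implies symmetry: <T z, z> is real,
    and its imaginary part at z = x + i y is Re <T y, x> - Re <T x, y>, up to
    terms that vanish for the same reason. *)
Lemma positive_operatorP (T : H -> H) : positive_operator T <->
  [/\ bounded_operator T, symmetric_operator T & nonneg_form T].
Proof.
split => [[bT T0]|[bT sT T0]].
  have lT := bT.1.
  have Tim z : rip ('i *: T z) z = 0.
    by have := T0 z; rewrite innerE lecE /= oppr_eq0 => /andP[/eqP].
  split => // x; last by have := T0 x; rewrite innerE lecE => /andP[].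
  move=> y; have := Tim (x + 'i *: y).
  rewrite !(linopE _ lT) scalerDr scale_ii ripDl ripNl !ripDr Tim rip_ii add0r.
  rewrite -[rip (T y) ('i *: y)]opprK -rip_iC Tim oppr0 addr0 (ripC x).
  by move/eqP; rewrite subr_eq0 => /eqP.
split => // x; rewrite innerE lecE /= T0 andbT.
have := rip_iC (T x) x; rewrite (sT x) (linopZ _ bT.1) (ripC x).
lra.
Qed.

(** T^2 <= M T for 0 <= T <= M, read off from the nonnegativity of the form
    of T at M x - T x. *)
Lemma sqr_le_form (T : H -> H) (M : R) : linear T -> 0 < M ->
  (forall x, rnorm (T x) <= M * rnorm x) ->
  symmetric_operator T -> nonneg_form T ->
  forall x, rnorm (T x) ^+ 2 <= M * rip (T x) x.
Proof.
move=> lT M0 TM sT T0 x.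
have := T0 (M%:C *: x - T x).
rewrite !(linopE _ lT) !ripE (sT (T x) x) !rip_self.
have h : rip (T (T x)) (T x) <= M * rnorm (T x) ^+ 2.
  apply: (le_trans (rip_le _ _)).
  by rewrite expr2 mulrA ler_wpM2r // rnorm_ge0.
move=> h2; rewrite -(ler_pM2l M0); lra.
Qed.

(** The loss is 2 <T x, x> / M - |T x|^2 / M^2, and [sqr_le_form] bounds
    <T x, x> / M below by |T x|^2 / M^2. *)
Lemma rnorm_sqr_damping (T : H -> H) (M : R) : linear T -> 0 < M ->
  (forall x, rnorm (T x) <= M * rnorm x) ->
  symmetric_operator T -> nonneg_form T ->
  forall x, rnorm (x - (M^-1)%:C *: T x) ^+ 2 <=
    rnorm x ^+ 2 - (M^-1 * rnorm (T x)) ^+ 2.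
Proof.
move=> lT M0 TM sT T0 x.
rewrite -!rip_self !ripE !rip_self (ripC x).
have h := sqr_le_form _ _ lT M0 TM sT T0 x.
have : (M^-1 * rnorm (T x)) ^+ 2 <= M^-1 * rip (T x) x.
  rewrite exprMn expr2 -mulrA ler_wpM2l ?invr_ge0 ?(ltW M0) // mulrC.
  by rewrite ler_pdivrMr // mulrC.
lra.
Qed.

End Riesz.

(** * Positive square roots *)

Section SquareRoot.
Context {R : realType} {H : hilbertType R}.
Implicit Types (x y z : H).

(** Iterates for the equation Y = (B + Y^2) / 2, that is (1 - Y)^2 = 1 - B. *)
Fixpoint sqrt_iter (B : H -> H) n : H -> H :=
  if n is n'.+1 then
    fun x => (2^-1)%:C *: (B x + sqrt_iter B n' (sqrt_iter B n' x))
  else fun=> 0.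

(** The scalar recursion majorising the norms of [sqrt_iter B] for a
    contraction B. *)
Fixpoint sqrt_bound n : R :=
  if n is n'.+1 then 2^-1 * (1 + sqrt_bound n' ^+ 2) else 0.

Lemma sqrt_bound_ge0 n : 0 <= sqrt_bound n.
Proof. by elim: n => //= n _; rewrite mulr_ge0 // addr_ge0 ?sqr_ge0. Qed.

Lemma sqrt_bound_le1 n : sqrt_bound n <= 1.
Proof.
elim: n => [|n IH] /=; first exact: ler01.
have : sqrt_bound n ^+ 2 <= 1 by rewrite expr_le1 // sqrt_bound_ge0.
lra.
Qed.

Lemma sqrt_bound_homo : {homo sqrt_bound : n m / (n <= m)%N >-> n <= m}.
Proof.
apply: homo_leq; [exact: lexx|exact: le_trans|] => n.
have := sqr_ge0 (1 - sqrt_bound n); rewrite /=; lra.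
Qed.

Section Contraction.
Variables (B : H -> H) (lB : linear B).
Hypothesis B1 : forall x, rnorm (B x) <= rnorm x.

Local Notation Y := (sqrt_iter B).
Local Notation y := sqrt_bound.

Lemma sqrt_iter_linear n : linear (Y n).
Proof.
elim: n => [|n IH] a u v /=; first by rewrite scaler0 addr0.
rewrite !IH lB scalerDr !scalerDr !scalerA -!(mulrC a).
by rewrite addrACA.
Qed.

Lemma sqrt_iter_le n x : rnorm (Y n x) <= y n * rnorm x.
Proof.
elim: n x => [|n IH] x /=; first by rewrite /rnorm normr0 mul0r.
rewrite rnormZr gtr0_norm ?invr_gt0 // -mulrA ler_wpM2l ?invr_ge0 //.
apply: (le_trans (ler_rnormD _ _)); rewrite mulrDl mul1r lerD //.
apply: (le_trans (IH _)); rewrite expr2 -mulrA ler_wpM2l //.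
exact: sqrt_bound_ge0.
Qed.

(** Induct through U^2 - V^2 = U (U - V) + (U - V) V, which needs no
    commutation between U and V; the scalar recursion satisfies the same
    identity, so the bound is reproduced exactly. *)
Lemma sqrt_iterB n k x :
  rnorm (Y (n + k) x - Y n x) <= (y (n + k) - y n) * rnorm x.
Proof.
elim: n x => [|n IH] x; first by rewrite add0n /= !subr0 sqrt_iter_le.
rewrite addSn /= -scalerBr rnormZr gtr0_norm ?invr_gt0 //.
have -> : B x + Y (n + k) (Y (n + k) x) - (B x + Y n (Y n x)) =
    Y (n + k) (Y (n + k) x - Y n x) + (Y (n + k) (Y n x) - Y n (Y n x)).
  rewrite (linopD _ (sqrt_iter_linear (n + k))) (linopN _ (sqrt_iter_linear (n + k))).
  by rewrite subrKA opprD addrACA subrr add0r.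
rewrite -mulrBr -mulrA ler_wpM2l ?invr_ge0 //.
rewrite [X in X * _](_ : _ = y (n + k) * (y (n + k) - y n) +
  (y (n + k) - y n) * y n); last by ring.
rewrite mulrDl; apply: (le_trans (ler_rnormD _ _)); rewrite lerD //.
  apply: (le_trans (sqrt_iter_le _ _)); rewrite -mulrA.
  by rewrite ler_wpM2l // sqrt_bound_ge0.
apply: (le_trans (IH _)); rewrite -mulrA ler_wpM2l ?sqrt_iter_le //.
by rewrite subr_ge0 sqrt_bound_homo // leq_addr.
Qed.

Lemma sqrt_iter_symmetric n : symmetric_operator B -> symmetric_operator (Y n).
Proof.
move=> sB; elim: n => [|n IH] u v /=; first by rewrite /rip linear0l linear0r.
by rewrite !ripE sB !IH.
Qed.

(** The scalar bounds increase and stay below 1, so by [sqrt_iterB] the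
    iterates converge pointwise, at a rate uniform on bounded sets; each
    property of the iterates then passes to the limit. *)
Lemma sqrt_iter_limit : symmetric_operator B -> exists L : H -> H,
  [/\ linear L, forall x, rnorm (L x) <= rnorm x, symmetric_operator L &
      forall x, L x = (2^-1)%:C *: (B x + L (L x))].
Proof.
move=> sB.
have ubd : has_ubound (range y).
  by exists 1 => _ [n _ <-]; exact: sqrt_bound_le1.
pose l := sup (range y); pose e n := l - y n.
have yl n : y n <= l by apply: ub_le_sup => //; exists n.
have e_ge0 n : 0 <= e n by rewrite subr_ge0.
have e_homo n : e n.+1 <= e n by rewrite lerB // sqrt_bound_homo.
have l1 : l <= 1.
  by apply: ge_sup; [exists (y 0), 0%N|move=> _ [n _ <-]; exact: sqrt_bound_le1].
have e0 : e @ \oo --> 0.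
  rewrite -(subrr l); apply: cvgB; first exact: cvg_cst.
  by apply: nondecreasing_cvgn => //; exact: sqrt_bound_homo.
have /choice[L LY] : forall x, exists z, forall n, rnorm (z - Y n x) <= e n * rnorm x.
  move=> x; apply: hilbert_complete.
    move=> n m nm; rewrite -(subnKC nm); apply: (le_trans (sqrt_iterB _ _ _)).
    by rewrite ler_wpM2r ?rnorm_ge0 // lerB.
  rewrite -(mul0r (rnorm x)); apply: cvgM => //; exact: cvg_cst.
have squeeze (D : H) (K : R) : (forall n, rnorm D <= K * e n) -> D = 0.
  move=> h; apply: rnorm_eq0; apply/eqP; rewrite eq_le rnorm_ge0 andbT.
  exact: le0_of_cvg0 h e0.
have lY := sqrt_iter_linear.
have LB x : rnorm (L x) <= rnorm x.
  have := LY x 0%N; rewrite /= subr0 => /le_trans; apply.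
  by rewrite /e /= subr0 -[leRHS]mul1r ler_wpM2r ?rnorm_ge0.
have lL : linear L.
  move=> a u v; apply/eqP; rewrite -subr_eq0; apply/eqP.
  apply: (squeeze _ (rnorm (a *: u + v) + complex.Re `|a| * rnorm u + rnorm v)) => n.
  have -> : L (a *: u + v) - (a *: L u + L v) =
      (L (a *: u + v) - Y n (a *: u + v)) - (a *: (L u - Y n u) + (L v - Y n v)).
    by rewrite lY scalerBr addrACA -opprD opprB subrKA.
  have h1 := ler_rnormD (L (a *: u + v) - Y n (a *: u + v))
    (- (a *: (L u - Y n u) + (L v - Y n v))).
  have h2 := ler_rnormD (a *: (L u - Y n u)) (L v - Y n v).
  have a0 : 0 <= complex.Re `|a|.
    by rewrite -lecR RRe_real ?normr_real // normr_ge0.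
  rewrite rnormN in h1; rewrite rnormZ in h2.
  have h3 := ler_wpM2l a0 (LY u n).
  have h4 := LY (a *: u + v) n; have h5 := LY v n.
  lra.
exists L; split => //.
- move=> u v.
  have K n : `|rip (L u) v - rip u (L v)| <= 2 * rnorm u * rnorm v * e n.
    have -> : rip (L u) v - rip u (L v) =
        rip (L u - Y n u) v - rip u (L v - Y n v).
      by rewrite !ripE (sqrt_iter_symmetric n sB u v); ring.
    have A1 : `|rip (L u - Y n u) v| <= e n * rnorm u * rnorm v.
      apply: (le_trans (normr_rip_le _ _)).
      by rewrite ler_wpM2r ?rnorm_ge0.
    have A2 : `|rip u (L v - Y n v)| <= rnorm u * (e n * rnorm v).
      apply: (le_trans (normr_rip_le _ _)).
      by rewrite ler_wpM2l ?rnorm_ge0.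
    apply: (le_trans (ler_normB _ _)); lra.
  apply/eqP; rewrite -subr_eq0 -normr_eq0 eq_le normr_ge0 andbT.
  exact: le0_of_cvg0 K e0.
- move=> x; apply/eqP; rewrite -subr_eq0; apply/eqP.
  apply: (squeeze _ (2 * rnorm x)) => n.
  have -> : L x - (2^-1)%:C *: (B x + L (L x)) = (L x - Y n.+1 x) -
     (2^-1)%:C *: (Y n (L x - Y n x) + (L (L x) - Y n (L x))).
    rewrite !(linopE _ (lY n)) /=; apply: rip_ext => z; rewrite !ripE; ring.
  apply: (le_trans (ler_rnormD _ _)); rewrite rnormN rnormZr gtr0_norm ?invr_gt0 //.
  have A1 : rnorm (L x - Y n.+1 x) <= e n * rnorm x.
    by apply: (le_trans (LY _ _)); rewrite ler_wpM2r ?rnorm_ge0.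
  have A2 := ler_rnormD (Y n (L x - Y n x)) (L (L x) - Y n (L x)).
  have A3 : rnorm (Y n (L x - Y n x)) <= e n * rnorm x.
    apply: (le_trans (sqrt_iter_le _ _)); apply: le_trans (LY x n).
    by rewrite -[leRHS]mul1r ler_wpM2r ?rnorm_ge0 ?sqrt_bound_le1.
  have A4 : rnorm (L (L x) - Y n (L x)) <= e n * rnorm x.
    by apply: (le_trans (LY _ _)); rewrite ler_wpM2l.
  lra.
Qed.

End Contraction.

Lemma bounded_lin_comb (S T : H -> H) (a b : R[i]) :
  bounded_operator S -> bounded_operator T ->
  bounded_operator (fun x => a *: S x + b *: T x).
Proof.
move=> /bounded_rnormP[lS [M M0 SM]] /bounded_rnormP[lT [N N0 TN]].
have re_ge0 (c : R[i]) : 0 <= complex.Re `|c|.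
  by rewrite -lecR RRe_real ?normr_real // normr_ge0.
apply/bounded_rnormP; split.
  by move=> c u v; rewrite lS lT !scalerDr !scalerA -!(mulrC c) addrACA.
exists (complex.Re `|a| * M + complex.Re `|b| * N + 1) => [|x].
  by rewrite ltr_wpDl // addr_ge0 // mulr_ge0 // ltW.
apply: (le_trans (ler_rnormD _ _)); rewrite !rnormZ 2!mulrDl mul1r -!mulrA.
rewrite ler_wpDr ?rnorm_ge0 // lerD // ler_wpM2l //.
Qed.

Lemma bounded_id : bounded_operator (@id H).
Proof. by apply/bounded_rnormP; split => //; exists 1 => // x; rewrite mul1r. Qed.

(** Scale so that B = 1 - T / M is a contraction ([rnorm_sqr_damping]).  If
    Y = (B + Y^2) / 2 then (1 - Y)^2 = 1 - B = T / M, and 1 - Y is positive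
    because Y is a contraction. *)
Lemma positive_sqrt_exists (T : H -> H) : positive_operator T ->
  exists S, positive_operator S /\ op_sqr S = T.
Proof.
move=> /positive_operatorP[bT sT T0]; have /bounded_rnormP[lT [M M0 TM]] := bT.
pose B x := 1 *: x + (- M^-1)%:C *: T x.
have [lB _] : bounded_operator B by exact: bounded_lin_comb bounded_id bT.
have sB : symmetric_operator B.
  by move=> u v; rewrite /B !scale1r !ripE (sT u v).
have B1 x : rnorm (B x) <= rnorm x.
  rewrite -ler_sqr ?nnegrE ?rnorm_ge0 // /B scale1r rmorphN scaleNr.
  apply: (le_trans (rnorm_sqr_damping _ _ lT M0 TM sT T0 x)).
  by rewrite gerBl sqr_ge0.
have [L [lL L1 sL LE]] := sqrt_iter_limit _ lB B1 sB.
have bL : bounded_operator L.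
  by apply/bounded_rnormP; split => //; exists 1 => // x; rewrite mul1r.
pose s := Num.sqrt M.
pose S x := s%:C *: x + (- s)%:C *: L x.
have bS : bounded_operator S by exact: bounded_lin_comb bounded_id bL.
exists S; split.
  apply/positive_operatorP; split => //.
    by move=> u v; rewrite /S !ripE (sL u v).
  move=> x; rewrite /S !ripE mulNr -mulrBr mulr_ge0 ?sqrtr_ge0 // subr_ge0.
  rewrite rip_self expr2; apply: (le_trans (rip_le _ _)).
  by rewrite ler_wpM2r ?rnorm_ge0.
have s2 : s * s = M by rewrite -expr2 sqr_sqrtr // ltW.
apply/funext => x; rewrite /op_sqr /= /S; apply: rip_ext => z.
have := congr1 (fun w => rip w z) (LE x).
rewrite !(linopE _ lL) /B scale1r !ripE => hL.
have hT : M^-1 * rip (T x) z = rip x z - 2 * rip (L x) z + rip (L (L x)) z.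
  lra.
have -> : rip (T x) z = s * s * (M^-1 * rip (T x) z).
  by rewrite s2 mulVKf // gt_eqF.
rewrite hT; ring.
Qed.

Lemma comp_bounded (S T : H -> H) : bounded_operator S -> bounded_operator T ->
  bounded_operator (S \o T).
Proof.
move=> /bounded_rnormP[lS [M M0 SM]] /bounded_rnormP[lT [N N0 TN]].
apply/bounded_rnormP; split; first by move=> a u v /=; rewrite lT lS.
exists (M * N); first exact: mulr_gt0.
by move=> x /=; apply: (le_trans (SM _)); rewrite -mulrA ler_wpM2l // ltW.
Qed.

Lemma op_sqrtP (T : H -> H) : positive_operator T ->
  positive_operator (op_sqrt T) /\ op_sqr (op_sqrt T) = T.
Proof.
move=> /positive_sqrt_exists[S hS].
exact: (getPex (ex_intro (fun S => positive_operator S /\ op_sqr S = T) S hS)).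
Qed.

Lemma op_absP (A : H -> H) : bounded_operator A ->
  positive_operator (op_abs A) /\ op_sqr (op_abs A) = adjoint A \o A.
Proof.
move=> bA; apply: op_sqrtP; have [bS AS] := adjointP _ bA.
apply/positive_operatorP; split.
- exact: comp_bounded.
- by move=> x y /=; rewrite ripC -AS ripC AS.
- by move=> x /=; rewrite ripC -AS rip_self sqr_ge0.
Qed.

End SquareRoot.

(** * Intertwining of the moduli and the mixed Schwarz inequality *)

Section Moduli.
Context {R : realType} {H : hilbertType R}.
Implicit Types (x y z : H).

(** The archimedean property; it ends each argument in which a fixed quantity
    is gained at every step of an iteration that stays bounded. *)
Lemma le0_of_natmul_bounded (c K : R) : (forall n, n%:R * c <= K) -> c <= 0.
Proof.
move=> h; apply: (@le0_of_cvg0 _ _ K (fun n => n.+1%:R^-1)) => [n|].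
  by rewrite ler_pdivlMr // mulrC.
exact: cvg_harmonic.
Qed.

Section PositivePart.
Variables (Q : H -> H) (M : R).
Hypotheses (lQ : linear Q) (M0 : 0 < M).
Hypothesis QM : forall x, rnorm (Q x) <= M * rnorm x.
Hypotheses (sQ : symmetric_operator Q) (Q0 : nonneg_form Q).

(** Iterate d -> d - Q d / M from d = y, which only changes d by elements of
    the range of Q.  Each step with |Q d| > e costs at least (e / M)^2 of
    |d|^2, so only finitely many such steps are possible. *)
Lemma range_plus_small_image y (e : R) : 0 < e ->
  exists z, rnorm (y - Q z) <= rnorm y /\ rnorm (Q (y - Q z)) <= e.
Proof.
move=> e0; apply: contrapT => /forallNP no.
have step n : exists z,
    rnorm (y - Q z) ^+ 2 + n%:R * (M^-1 * e) ^+ 2 <= rnorm y ^+ 2.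
  elim: n => [|n [z hz]].
    by exists 0; rewrite linop0 // subr0 mul0r addr0.
  pose d := y - Q z; exists (z + (M^-1)%:C *: d).
  have -> : y - Q (z + (M^-1)%:C *: d) = d - (M^-1)%:C *: Q d.
    by rewrite !(linopE _ lQ) opprD addrA.
  have dy : rnorm d <= rnorm y.
    rewrite -ler_sqr ?nnegrE ?rnorm_ge0 //; apply: le_trans hz.
    by rewrite lerDl mulr_ge0 // sqr_ge0.
  have ed : e < rnorm (Q d).
    by rewrite ltNge; apply/negP => h; apply: (no z).
  have : (M^-1 * e) ^+ 2 <= (M^-1 * rnorm (Q d)) ^+ 2.
    rewrite ler_sqr ?nnegrE ?mulr_ge0 ?rnorm_ge0 ?invr_ge0 ?(ltW M0) ?(ltW e0) //.
    by rewrite ler_wpM2l ?invr_ge0 ?(ltW M0) ?(ltW ed).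
  have := rnorm_sqr_damping _ _ lQ M0 QM sQ Q0 d; rewrite -/d in hz.
  rewrite -natr1 mulrDl mul1r; lra.
have : (M^-1 * e) ^+ 2 <= 0.
  apply: (@le0_of_natmul_bounded _ (rnorm y ^+ 2)) => n.
  have [z] := step n; apply: le_trans; by rewrite lerDr sqr_ge0.
by rewrite leNgt exprn_gt0 // mulr_gt0 // invr_gt0.
Qed.

End PositivePart.

(** Since (1 + P/M) Z = Z (1 - Q/M), the vectors (1 + P/M)^n Z x are the
    images under Z of (1 - Q/M)^n x, which stay bounded.  But 1 + P/M
    increases the form of P, and it increases the squared norm of w by at
    least 2 <P w, w> / M; so the growth is linear in n unless
    <P Z x, Z x> = 0, that is P Z x = 0. *)
Lemma anticommuting_intertwiner (P Q Z : H -> H) :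
  positive_operator P -> positive_operator Q -> bounded_operator Z ->
  (forall x, P (Z x) = - Z (Q x)) -> forall x, P (Z x) = 0.
Proof.
move=> /positive_operatorP[/bounded_rnormP[lP [M1 M10 PM1]] sP P0].
move=> /positive_operatorP[/bounded_rnormP[lQ [M2 M20 QM2]] sQ Q0].
move=> /bounded_rnormP[lZ [K K0 ZK]] PZ x.
pose M := M1 + M2.
have M0 : 0 < M by rewrite addr_gt0.
have PM y : rnorm (P y) <= M * rnorm y.
  by apply: (le_trans (PM1 y)); rewrite ler_wpM2r ?rnorm_ge0 // lerDl ltW.
have QM y : rnorm (Q y) <= M * rnorm y.
  by apply: (le_trans (QM2 y)); rewrite ler_wpM2r ?rnorm_ge0 // lerDr ltW.
pose c := rip (P (Z x)) (Z x).
have step n : exists u, [/\ rnorm u <= rnorm x, c <= rip (P (Z u)) (Z u) &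
    n%:R * (2 * M^-1 * c) <= rnorm (Z u) ^+ 2].
  elim: n => [|n [u [ux cu nu]]]; first by exists x; rewrite mul0r sqr_ge0.
  exists (u - (M^-1)%:C *: Q u).
  have -> : Z (u - (M^-1)%:C *: Q u) = Z u + (M^-1)%:C *: P (Z u).
    by rewrite !(linopE _ lZ) PZ scalerN.
  have Mi : 0 <= M^-1 by rewrite invr_ge0 ltW.
  have p0 := mulr_ge0 Mi (sqr_ge0 (rnorm (P (Z u)))).
  split.
  - apply: le_trans ux; rewrite -ler_sqr ?nnegrE ?rnorm_ge0 //.
    apply: (le_trans (rnorm_sqr_damping _ _ lQ M0 QM sQ Q0 u)).
    by rewrite gerBl sqr_ge0.
  - rewrite !(linopE _ lP) !ripE (sP (P (Z u)) (Z u)) !rip_self.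
    have := mulr_ge0 (mulr_ge0 Mi Mi) (P0 (P (Z u))).
    lra.
  - rewrite -rip_self !ripE !rip_self (ripC (Z u)) -natr1 mulrDl mul1r.
    have := mulr_ge0 Mi p0.
    have := ler_wpM2l Mi cu.
    lra.
have c0 : c = 0.
  apply/eqP; rewrite eq_le P0 andbT.
  have : 2 * M^-1 * c <= 0.
    apply: (@le0_of_natmul_bounded _ ((K * rnorm x) ^+ 2)) => n.
    have [u [ux _ nu]] := step n; apply: (le_trans nu).
    rewrite ler_sqr ?nnegrE ?mulr_ge0 ?rnorm_ge0 ?(ltW K0) //.
    by apply: (le_trans (ZK u)); rewrite ler_wpM2l // ltW.
  by rewrite pmulr_rle0 // mulr_gt0 // invr_gt0.
apply/rnorm_eq0/eqP; rewrite -sqrf_eq0 eq_le sqr_ge0 andbT.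
by apply: (le_trans (sqr_le_form _ _ lP M0 PM sP P0 _)); rewrite -/c c0 mulr0.
Qed.

Lemma op_abs_sqr (A : H -> H) : bounded_operator A ->
  forall x, op_abs A (op_abs A x) = adjoint A (A x).
Proof.
by move=> bA x; have [_ /(congr1 (fun f => f x))] := op_absP _ bA.
Qed.

Lemma rnorm_op_abs (A : H -> H) : bounded_operator A ->
  forall x, rnorm (op_abs A x) = rnorm (A x).
Proof.
move=> bA x; have [/positive_operatorP[_ sP _] _] := op_absP _ bA.
have [_ adA] := adjointP _ bA.
apply/eqP; rewrite -(@eqrXn2 _ 2) ?rnorm_ge0 // -!rip_self.
by rewrite (sP x) op_abs_sqr // adA.
Qed.

(** The operator Z = P A^* - A^* Q satisfies P Z = - Z Q, hence P Z = 0.  As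
    |A v| = |P v|, also A Z = 0, and then
    |Z x|^2 = <A^* x, P Z x> - <Q x, A Z x> = 0. *)
Lemma op_abs_adjoint (A : H -> H) : bounded_operator A ->
  forall x, op_abs A (adjoint A x) = adjoint A (op_abs (adjoint A) x).
Proof.
move=> bA; have [bA' adA] := adjointP _ bA.
have [pP _] := op_absP _ bA; have [pQ _] := op_absP _ bA'.
have /positive_operatorP[bP sP _] := pP; have /positive_operatorP[bQ sQ _] := pQ.
set P := op_abs A in pP bP sP *; set Q := op_abs (adjoint A) in pQ bQ sQ *.
have PP := op_abs_sqr _ bA; have QQ := op_abs_sqr _ bA'.
rewrite adjointK // -/P -/Q in PP QQ.
pose Z x := 1 *: (P \o adjoint A) x + (-1) *: (adjoint A \o Q) x.
have ZE x : Z x = P (adjoint A x) - adjoint A (Q x).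
  by rewrite /Z scale1r scaleN1r.
have bZ : bounded_operator Z by apply: bounded_lin_comb; exact: comp_bounded.
have PZ : forall x, P (Z x) = 0.
  apply: (anticommuting_intertwiner _ _ _ pP pQ bZ) => x.
  by rewrite !ZE (linopD _ bP.1) (linopN _ bP.1) PP QQ opprB.
move=> x; apply/eqP; rewrite -subr_eq0 -ZE; apply/eqP/rnorm_eq0/eqP.
rewrite -sqrf_eq0 -rip_self {1}ZE ripDl ripNl sP PZ -(ripC (Z x)) -adA.
have -> : A (Z x) = 0.
  by apply: rnorm_eq0; rewrite -rnorm_op_abs // -/P PZ /rnorm normr0.
by rewrite /rip linear0l linear0r subr0.
Qed.

(** On the range of Q the inequality is the nonnegativity of the form of P at
    x - A^* z, since P A^* = A^* Q.  In general y = Q z + d with |d| <= |y|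
    and |A^* d| = |Q d| arbitrarily small, so the terms containing d
    disappear in the limit. *)
Lemma mixed_schwarz (A : H -> H) : bounded_operator A ->
  forall x y, 2 * rip (A x) y <=
    rip (op_abs A x) x + rip (op_abs (adjoint A) y) y.
Proof.
move=> bA x y; have [bA' adA] := adjointP _ bA.
have comm := op_abs_adjoint _ bA.
have [/positive_operatorP[bP sP P0] _] := op_absP _ bA.
have [/positive_operatorP[bQ sQ Q0] _] := op_absP _ bA'.
have nQ := rnorm_op_abs _ bA'.
have QQ := op_abs_sqr _ bA'.
set P := op_abs A in comm bP sP P0 *; set Q := op_abs (adjoint A) in comm bQ sQ Q0 nQ QQ *.
rewrite adjointK // -/Q in QQ.
have /bounded_rnormP[lQ [M M0 QM]] := bQ.
have on_range z : 2 * rip (A x) (Q z) <= rip (P x) x + rip (Q (Q z)) (Q z).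
  have e1 : rip (A x) (Q z) = rip (P x) (adjoint A z) by rewrite adA -comm (sP x).
  have e2 : rip (P (adjoint A z)) (adjoint A z) = rip (Q (Q z)) (Q z).
    by rewrite comm ripC -adA -QQ.
  have := P0 (x - adjoint A z).
  rewrite !(linopE _ bP.1) !ripE (sP (adjoint A z) x) (ripC _ (P x)) e1 e2; lra.
rewrite -subr_le0.
apply: (@le0_of_cvg0 _ _ (2 * rnorm x + 3 * rnorm y) (fun n => n.+1%:R^-1)).
  move=> n; set e := _^-1.
  have [|z [dy de]] := range_plus_small_image _ _ lQ M0 QM sQ Q0 y e.
    by rewrite invr_gt0.
  have := on_range z; set d := y - Q z in dy de.
  have -> : Q z = y - d by rewrite /d subKr.
  clearbody d.
  have h1 : rip (A x) d <= rnorm x * e.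
    rewrite adA; apply: (le_trans (rip_le _ _)).
    by rewrite ler_wpM2l ?rnorm_ge0 // -nQ.
  have h2 : - rip (Q d) y <= e * rnorm y.
    rewrite -ripNr; apply: (le_trans (rip_le _ _)); rewrite rnormN.
    by rewrite ler_wpM2r ?rnorm_ge0.
  have h3 : rip (Q d) d <= e * rnorm y.
    apply: (le_trans (rip_le _ _)).
    by rewrite ler_pM ?rnorm_ge0.
  rewrite !(linopE _ lQ) !ripE (sQ y d) (ripC y); lra.
exact: cvg_harmonic.
Qed.

Lemma rip_unit_scale (a : R[i]) x y :
  `|a| = 1 -> rip (a *: x) (a *: y) = rip x y.
Proof.
move=> a1; rewrite /rip linearZl_LR linearZr_LR /= mulrA -normCK a1.
by rewrite expr1n mul1r.
Qed.

(** The phase rotating the inner product onto the nonnegative half-line; any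
    phase will do when the inner product is zero. *)
Lemma exists_phase x y : exists2 a : R[i], `|a| = 1 &
  rip x (a *: y) = complex.Re `|inner x y|.
Proof.
set z := inner x y.
have ripa a : rip x (a *: y) = complex.Re (Num.conj a * z).
  by rewrite /rip linearZr_LR.
have [z0|z0] := eqVneq z 0.
  by exists 1; rewrite ?normr1 // ripa z0 normr0 mulr0.
have n0 : `|z| != 0 by rewrite normr_eq0.
exists (z / `|z|); first by rewrite normf_div normr_id divff.
rewrite ripa rmorphM fmorphV /= conj_normC mulrAC (mulrC _ z) -normCK expr2.
by rewrite mulfK.
Qed.

(** Apply [mixed_schwarz] to x and a x, where the phase a makes <A x, a x>
    equal to the modulus of <A x, x>; the form of |A^*| does not see a. *)
Lemma numerical_value_le (A : H -> H) : bounded_operator A ->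
  forall x, rnorm x = 1 ->
  complex.Re `|inner (A x) x| <=
    2^-1 * rnorm (op_abs A x + op_abs (adjoint A) x).
Proof.
move=> bA x x1; have [bA' _] := adjointP _ bA.
have [/positive_operatorP[[lP _] _ _] _] := op_absP _ bA.
have [/positive_operatorP[[lQ _] _ _] _] := op_absP _ bA'.
have [a a1 <-] := exists_phase (A x) x.
have := mixed_schwarz _ bA x (a *: x).
rewrite (linopZ _ lQ) rip_unit_scale //.
have := rip_le (op_abs A x + op_abs (adjoint A) x) x.
rewrite x1 mulr1 ripDl; lra.
Qed.

Lemma rnorm_le_opnorm (T : H -> H) : bounded_operator T ->
  forall x, rnorm x = 1 -> rnorm (T x) <= opnorm T.
Proof.
move=> /bounded_rnormP[_ [M _ TM]] x x1; apply: ub_le_sup.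
  exists M => _ [y /= y1 <-]; apply: (le_trans (TM y)).
  by rewrite /rnorm y1 mulr1.
by exists x => //=; rewrite normE_rnorm x1.
Qed.

Lemma sup_nonneg (E : set R) : (forall r, E r -> 0 <= r) -> 0 <= sup E.
Proof.
move=> E0; have [[[r Er] ubE]|/sup_out -> //] := pselect (has_sup E).
exact: le_trans (E0 _ Er) (ub_le_sup ubE Er).
Qed.

Lemma opnorm_ge0 (T : H -> H) : 0 <= opnorm T.
Proof. by apply: sup_nonneg => _ [x _ <-]; exact: rnorm_ge0. Qed.

(** Over the zero space there is no unit vector and the radius is 0, whence
    the assumption 0 <= K. *)
Lemma numerical_radius_le (A : H -> H) (K : R) : 0 <= K ->
  (forall x, rnorm x = 1 -> complex.Re `|inner (A x) x| <= K) ->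
  0 <= numerical_radius A <= K.
Proof.
move=> K0 h; apply/andP; split.
  apply: sup_nonneg => _ [x _ <-].
  by rewrite -lecR RRe_real ?normr_real // normr_ge0.
rewrite /numerical_radius; set E := (X in sup X).
have [->|/set0P E0] := eqVneq E set0; first by rewrite sup0.
by apply: ge_sup => // _ [x /= x1 <-]; apply: h; rewrite /rnorm x1.
Qed.

(** Since 2 (P^2 + Q^2) = (P + Q)^2 + (P - Q)^2, the difference of the two
    sides is (1/2 - c) |(P - Q) x|^2. *)
Lemma half_sum_sqr_le (P Q : H -> H) (c : R) : positive_operator P ->
  positive_operator Q -> c <= 2^-1 ->
  forall x, 2^-1 * rnorm (P x + Q x) ^+ 2 <=
    rip (op_sqr P x + op_sqr Q x - c%:C *: op_sqr (P - Q) x) x.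
Proof.
move=> /positive_operatorP[[lP _] sP _] /positive_operatorP[[lQ _] sQ _] c2 x.
have -> : op_sqr (P - Q) x = P (P x - Q x) - Q (P x - Q x) by [].
have := mulr_ge0 (_ : 0 <= 2^-1 - c) (sqr_ge0 (rnorm (P x - Q x))).
rewrite subr_ge0 => /(_ c2).
rewrite /op_sqr /= -!rip_self !(linopE _ lP) !(linopE _ lQ) !ripE.
rewrite !(sP (P x)) !(sP (Q x)) !(sQ (P x)) !(sQ (Q x)); lra.
Qed.

(** The quotient is the smaller of t and 1 - t. *)
Lemma ratio_le_half (t : R) : 0 <= t <= 1 ->
  t * (1 - t) / Num.max t (1 - t) <= 2^-1.
Proof.
move=> /andP[t0 t1]; have [h|h] := leP t (1 - t).
  by have [->|?] := eqVneq (1 - t) 0; [rewrite invr0 mulr0|rewrite mulfK //; lra].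
by rewrite mulrAC mulfV ?mul1r; lra.
Qed.

End Moduli.

Theorem theorem2p3 (R : realType) (H : hilbertType R) (A : H -> H)
    (hA : bounded_operator A) (t : R) (ht : 0 <= t <= 1) :
  let r := Num.max t (1 - t) in
  numerical_radius A ^+ 2 <=
    2^-1 * opnorm (op_sqr (op_abs A) + op_sqr (op_abs (adjoint A))
      - (t * (1 - t) / r)%:C *: op_sqr (op_abs A - op_abs (adjoint A))).
Proof.
cbv zeta; set c := t * (1 - t) / _.
have c2 : c <= 2^-1 by exact: ratio_le_half.
have [pP _] := op_absP _ hA; have [bA' _] := adjointP _ hA.
have [pQ _] := op_absP _ bA'.
set P := op_abs A in pP *; set Q := op_abs (adjoint A) in pQ *.
set T := (X in opnorm X).
have bT : bounded_operator T.
  have [bP _] := pP; have [bQ _] := pQ.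
  pose D x := 1 *: P x + (-1) *: Q x.
  have bD : bounded_operator D by exact: bounded_lin_comb.
  pose S x := 1 *: (P \o P) x + 1 *: (Q \o Q) x.
  have bS : bounded_operator S.
    exact: bounded_lin_comb (comp_bounded _ _ bP bP) (comp_bounded _ _ bQ bQ).
  have -> : T = (fun x => 1 *: S x + (- c%:C) *: (D \o D) x).
    by apply/funext => x; rewrite /S /D /= !scale1r !scaleN1r scaleNr.
  exact: bounded_lin_comb bS (comp_bounded _ _ bD bD).
have K0 : 0 <= 2^-1 * opnorm T by rewrite mulr_ge0 ?opnorm_ge0 // invr_ge0.
have /andP[w0 wK] : 0 <= numerical_radius A <= Num.sqrt (2^-1 * opnorm T).
  apply: numerical_radius_le => [|x x1]; first exact: sqrtr_ge0.
  have h1 := numerical_value_le _ hA x x1; rewrite -/P -/Q in h1.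
  apply: (le_trans h1).
  rewrite -[leLHS]ger0_norm ?mulr_ge0 ?rnorm_ge0 ?invr_ge0 // -sqrtr_sqr.
  rewrite ler_wsqrtr // exprMn expr2 -mulrA ler_wpM2l ?invr_ge0 //.
  apply: (le_trans (half_sum_sqr_le _ _ _ pP pQ c2 x)).
  apply: le_trans (rnorm_le_opnorm _ bT x x1).
  by apply: (le_trans (rip_le _ _)); rewrite x1 mulr1.
rewrite -(sqr_sqrtr K0) ler_sqr ?nnegrE //; exact: sqrtr_ge0.
Qed.
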